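(* Let $X=(X,\mathcal{U})$ be a compact uniform space and let $\varphi_{0,\infty}=\{\varphi_j\}_{j=0}^{\infty}$ be a sequence of (arbitrary) multivalued maps $\varphi_j: X\multimap X$, $j\in\mathbb{N}\cup\{0\}$. Then $h^{\mathrm{sep}}(\varphi_{0,\infty})=h^{\mathrm{span}}(\varphi_{0,\infty})$.
   Context: A uniformity on a nonempty set $S$ is a nonempty family $\mathcal{U}$ of pseudometrics on $S$ such that: (U1) if $p_0,p_1\in\mathcal{U}$, then $\max\{p_0,p_1\}\in\mathcal{U}$; (U2) if $p$ is a pseudometric on $S$ such that for every $\varepsilon>0$ there exist $p_\varepsilon\in\mathcal{U}$ and $\delta>0$ with $p_\varepsilon(x,y)<\delta\Rightarrow p(x,y)<\varepsilon$ for all $x,y\in S$, then $p\in\mathcal{U}$; (U3) if $x\neq y$ in $S$, then $p(x,y)>0$ for some $p\in\mathcal{U}$. A uniform space is a nonempty set with a uniformity; its (Hausdorff) topology has as base the balls $B_p(x,r)=\{y: p(x,y)<r\}$, $p\in\mathcal{U}$, $r>0$. It is compact if this topology is compact. A multivalued map $\varphi:X\multimap X$ assigns to each $x\in X$ a nonempty subset $\varphi(x)\subset X$ (no regularity is assumed). The $n$-orbits of $\varphi_{0,\infty}$ are $\mathrm{Orb}_1(\varphi_{0,\infty})=X$ and, for $n\ge 2$, $\mathrm{Orb}_n(\varphi_{0,\infty})=\{(x_0,\ldots,x_{n-1})\in X^n: x_{i+1}\in\varphi_i(x_i),\ i=0,\ldots,n-2\}$. For a pseudometric $p$ on a set $W$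 and $\varepsilon>0$: $S\subset W$ is $(p,\varepsilon)$-separated if $p(x,y)>\varepsilon$ for all distinct $x,y\in S$; $R\subset W$ is $(p,\varepsilon)$-spanning in $Y\subset W$ if for every $y\in Y$ there is $x\in R$ with $p(x,y)\le\varepsilon$. For $p\in\mathcal{U}$, put $p_n((x_i),(y_i))=\max_{0\le i\le n-1}p(x_i,y_i)$ on $X^n$. A set $S\subset\mathrm{Orb}_n(\varphi_{0,\infty})$ is $(p,\varepsilon,n)$-separated for $\varphi_{0,\infty}$ if it is $(p_n,\varepsilon)$-separated; a set $R\subset\mathrm{Orb}_n(\varphi_{0,\infty})$ is $(p,\varepsilon,n)$-spanning for $\varphi_{0,\infty}$ if it is $(p_n,\varepsilon)$-spanning in $\mathrm{Orb}_n(\varphi_{0,\infty})$. Let $s(\varphi_{0,\infty},p,\varepsilon,n)$ be the largest cardinality of a $(p,\varepsilon,n)$-separated set and $r(\varphi_{0,\infty},p,\varepsilon,n)$ the smallest cardinality of a $(p,\varepsilon,n)$-spanning set (both are finite). Define $$h^{\mathrm{sep}}(\varphi_{0,\infty})=\sup_{p\in\mathcal{U},\varepsilon>0}\limsup_{n\to\infty}\frac1n\log s(\varphi_{0,\infty},p,\varepsilon,n),\qquad h^{\mathrm{span}}(\varphi_{0,\infty})=\sup_{p\in\mathcal{U},\varepsilon>0}\limsup_{n\to\infty}\frac1n\log r(\varphi_{0,\infty},p,\varepsilon,n).$$ *)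

(* Defs.v *)
From HB Require Import structures.
From mathcomp Require Import all_boot all_order all_algebra.
From mathcomp Require Import all_classical all_reals all_analysis.
Set Implicit Arguments.
Unset Strict Implicit.
Unset Printing Implicit Defensive.
Import Order.TTheory GRing.Theory Num.Theory.
Local Open Scope classical_set_scope.
Local Open Scope ring_scope.

Record pseudometric (R : realType) (S : Type) (p : S -> S -> R) : Prop :=
  Pseudometric {
    pseudometric_ge0 : forall x y, 0 <= p x y ;
    pseudometric_refl : forall x, p x x = 0 ;
    pseudometric_sym : forall x y, p x y = p y x ;
    pseudometric_triangle : forall x y z, p x z <= p x y + p y z }.

Record uniformity (R : realType) (S : Type) (U : set (S -> S -> R)) : Prop :=
  Uniformity {
    uniformity_pseudometric : forall p, U p -> pseudometric p ;
    uniformity_neq0 : U !=set0 ;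
    uniformity_max : forall p0 p1, U p0 -> U p1 ->
      U (fun x y => Num.max (p0 x y) (p1 x y)) ;
    uniformity_saturated : forall p, pseudometric p ->
      (forall eps, 0 < eps -> exists p_eps delta, [/\ U p_eps, 0 < delta &
         forall x y, p_eps x y < delta -> p x y < eps]) ->
      U p ;
    uniformity_separates : forall x y, x <> y -> exists2 p, U p & 0 < p x y }.

(* Not the library's [uniformType]: a uniformity here is a family of
   pseudometrics, and it is Hausdorff. *)
Record uniformSpace (R : realType) := UniformSpace {
  us_carrier :> Type ;
  us_unif : set (us_carrier -> us_carrier -> R) ;
  us_neq0 : [set: us_carrier] !=set0 ;
  us_unifP : uniformity us_unif }.

Definition uball (R : realType) (S : Type) (p : S -> S -> R) (x : S) (r : R) :
  set S := [set y | p x y < r].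

Section UniformTopology.
Variables (R : realType) (X : uniformSpace R).

Definition uballs : set (set X) :=
  [set B | exists p x r, [/\ us_unif p, 0 < r & B = uball p x r]].

Lemma uballs_cover : \bigcup_(B in uballs) B = [set: X].
Proof.
apply/seteqP; split => // x _.
have [p Up] := uniformity_neq0 (us_unifP X).
exists (uball p x 1); first by exists p, x, 1; split.
by rewrite /uball /= (pseudometric_refl (uniformity_pseudometric (us_unifP X) Up)).
Qed.

Lemma uballs_join (B C : set X) (t : X) : uballs B -> uballs C -> B t -> C t ->
  exists D : set X, [/\ uballs D, D t & D `<=` B `&` C].
Proof.
move=> [p [x [r [Up r0 ->]]]] [q [y [s [Uq s0 ->]]]] /= ptr qts.
have U := us_unifP X.
have Pp := uniformity_pseudometric U Up.
have Pq := uniformity_pseudometric U Uq.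
pose e := Num.min (r - p x t) (s - q y t).
have e0 : 0 < e by rewrite /e lt_min !subr_gt0 ptr qts.
exists (uball (fun u v => Num.max (p u v) (q u v)) t e); split.
- exists (fun u v => Num.max (p u v) (q u v)), t, e; split=> //.
  exact: uniformity_max.
- by rewrite /uball /= (pseudometric_refl Pp) (pseudometric_refl Pq) maxxx.
- move=> z; rewrite /uball /= gt_max !lt_min => /andP[/andP[h1 _] /andP[_ h2]].
  split.
    by apply: le_lt_trans (pseudometric_triangle Pp _ t _) _; rewrite -ltrBrDl.
  by apply: le_lt_trans (pseudometric_triangle Pq _ t _) _; rewrite -ltrBrDl.
Qed.

HB.instance Definition _ := gen_eqMixin (us_carrier X).
HB.instance Definition _ := gen_choiceMixin (us_carrier X).
HB.instance Definition _ :=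
  @isBaseTopological.Build (us_carrier X) (set X) uballs id
    uballs_cover uballs_join.

End UniformTopology.

Section SeparatedSpanning.
Variables (R : realType) (W : choiceType) (q : W -> W -> R) (eps : R).

Definition separated (S : set W) : Prop :=
  forall x y, S x -> S y -> x <> y -> eps < q x y.

Definition spanning (Y A : set W) : Prop :=
  forall y, Y y -> exists2 x, A x & q x y <= eps.

Local Open Scope ereal_scope.

(* [counting] is the number of elements of a finite set and +oo otherwise, so
   the two cardinalities below are total in [0, +oo]; the supremum and infimum
   are attained as soon as they are finite. *)
Definition separated_card (Y : set W) : \bar R :=
  ereal_sup [set counting S | S in [set S | S `<=` Y /\ separated S]].

Definition spanning_card (Y : set W) : \bar R :=
  ereal_inf [set counting A | A in [set A | A `<=` Y /\ spanning Y A]].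

End SeparatedSpanning.

Section Entropy.
Variables (R : realType) (X : uniformSpace R).
Implicit Types (p : X -> X -> R) (phi : nat -> X -> set X) (eps : R) (n : nat).

(* For n = 1 the condition is void and this is all of X^1. *)
Definition Orb phi n : set ('I_n -> X) :=
  [set x | forall i j : 'I_n, j = i.+1 :> nat -> phi i (x i) (x j)].

(* The default value 0 is harmless: pseudometrics are nonnegative. *)
Definition orbit_dist p n (x y : 'I_n -> X) : R :=
  \big[Num.max/0]_(i < n) p (x i) (y i).

Definition sep_number phi p eps n : \bar R :=
  separated_card (@orbit_dist p n) eps (@Orb phi n).

Definition span_number phi p eps n : \bar R :=
  spanning_card (@orbit_dist p n) eps (@Orb phi n).

Local Open Scope ereal_scope.

(* The values at n = 0 do not affect the upper limits. *)
Definition h_sep phi : \bar R :=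
  ereal_sup [set h | exists p eps, [/\ us_unif p, (0 < eps)%R &
    h = limn_esup (fun n => (n%:R^-1)%:E * lne (sep_number phi p eps n))]].

Definition h_span phi : \bar R :=
  ereal_sup [set h | exists p eps, [/\ us_unif p, (0 < eps)%R &
    h = limn_esup (fun n => (n%:R^-1)%:E * lne (span_number phi p eps n))]].

End Entropy.

(* Main.v *)
Require Import Defs.
From HB Require Import structures.
From mathcomp Require Import all_boot all_order all_algebra.
From mathcomp Require Import all_classical all_reals all_analysis.
Import Order.TTheory GRing.Theory Num.Theory.
Local Open Scope classical_set_scope.
Local Open Scope ring_scope.

(** At a fixed pseudometric [q] and scale [eps], the two counting functions
    interlace:
      [spanning_card q eps Y <= separated_card q eps Y] and
      [separated_card q (2 * eps) Y <= spanning_card q eps Y].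
    The first holds because a separated set that is maximal for inclusion is
    spanning: a point at distance more than [eps] from all its elements could be
    added to it.  The second holds because two points within [eps] of a common
    point are within [2 * eps] of each other, so sending each point of a
    [2 * eps]-separated set to a point of the [eps]-spanning set nearby is
    injective.

    On [n]-orbits the maximum distance [orbit_dist p n] is again a pseudometric,
    so both inequalities hold for every [n] and survive [1/n log] and the upper
    limit.  The first gives [h_span <= h_sep] scale by scale.  For the converse,
    the separated growth rate at scale [eps] is at most the spanning growth rate
    at scale [eps / 2], and the supremum over all scales absorbs the loss.

    The cardinalities live in [0, +oo].  Zorn's lemma, rather than a largest
    cardinality, supplies the maximal separated set, so finite and infinite
    values are treated alike. *)

Lemma le_counting (T : choiceType) (R : realType) (S A : set T) :
  (S #<= A)%card -> (counting S <= counting A :> \bar R)%E.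
Proof.
move=> leSA; rewrite /counting.
case: (asboolP (finite_set A)) => [finA|_]; last by rewrite leey.
rewrite asboolT; last exact: card_le_finite leSA finA.
have [n /[dup] An /card_fset_set ->] := finA.
rewrite lee_fin ler_nat; apply: geq_card_fset_set.
by rewrite -(card_le_eqr An).
Qed.

Lemma counting_ge0 (T : choiceType) (R : realType) (S : set T) :
  (0 <= counting S :> \bar R)%E.
Proof. by rewrite /counting; case: ifP => _; rewrite ?leey // lee_fin. Qed.

Section SeparatedVersusSpanning.
Variables (R : realType) (W : choiceType) (q : W -> W -> R).
Hypothesis q_pseudo : pseudometric q.

(** Being separated is a condition on pairs of points, hence inherited by unions
    of chains, which is what Zorn's lemma asks for. *)
Lemma exists_maximal_separated (eps : R) (Y : set W) :
  exists A : set W, (A `<=` Y /\ Defs.separated q eps A) /\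
    forall B, A `<` B -> ~ (B `<=` Y /\ Defs.separated q eps B).
Proof.
apply: (@Zorn_bigcup W (fun S => S `<=` Y /\ Defs.separated q eps S)) => F FP Ftot.
split=> [x [S FS Sx]|x y [S FS Sx] [T FT Ty] xy].
  by have [SY _] := FP _ FS; exact: SY.
have [ST|TS] := Ftot _ _ FS FT.
- by have [_ sepT] := FP _ FT; apply: sepT => //; exact: ST.
- by have [_ sepS] := FP _ FS; apply: sepS => //; exact: TS.
Qed.

Lemma maximal_separated_spanning (eps : R) (Y A : set W) : 0 <= eps ->
  A `<=` Y -> Defs.separated q eps A ->
  (forall B, A `<` B -> ~ (B `<=` Y /\ Defs.separated q eps B)) ->
  spanning q eps Y A.
Proof.
move=> eps0 AY sepA maxA y Yy; apply: contrapT => far.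
have farA x : A x -> eps < q x y.
  by move=> Ax; rewrite ltNge; apply/negP => ?; apply: far; exists x.
have nAy : ~ A y.
  by move=> /farA; rewrite (pseudometric_refl q_pseudo) ltNge eps0.
apply: (maxA (A `|` [set y])).
  split; first exact: subsetUl.
  by move=> /(_ y) Ay; apply: nAy; apply: Ay; right.
split; first by move=> x [/AY //|->].
move=> x z [Ax|->] [Az|->] xz //; [exact: sepA|exact: farA|].
by rewrite (pseudometric_sym q_pseudo); exact: farA.
Qed.

Lemma spanning_card_le_separated (eps : R) (Y : set W) : 0 <= eps ->
  (spanning_card q eps Y <= separated_card q eps Y)%E.
Proof.
move=> eps0; have [A [[AY sepA] maxA]] := exists_maximal_separated eps Y.
apply: (@le_trans _ _ (counting A)).
  apply: ereal_inf_lbound; exists A => //; split=> //.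
  exact: maximal_separated_spanning.
by apply: ereal_sup_ubound; exists A.
Qed.

(** The map sending a point of [S] to a point of [A] near it is injective, since
    its fibres have diameter at most [eps + eps]. *)
Lemma separated_card_le_spanning_set (eps : R) (Y S A : set W) : S `<=` Y ->
  Defs.separated q (eps + eps) S -> spanning q eps Y A -> (S #<= A)%card.
Proof.
move=> SY sepS spanA.
have near_A x : exists a, S x -> A a /\ q a x <= eps.
  have [Sx|nSx] := pselect (S x); last by exists x.
  by have [a Aa ax] := spanA x (SY _ Sx); exists a.
have [f fP] := choice near_A.
have f_inj : {in S &, injective f}.
  move=> x y /set_mem Sx /set_mem Sy fxy; apply: contrapT => xy.
  have [_ xle] := fP x Sx; have [_ yle] := fP y Sy.
  have := sepS x y Sx Sy xy; rewrite ltNge => /negP; apply.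
  apply: le_trans (pseudometric_triangle q_pseudo x (f x) y) _.
  by apply: lerD; [rewrite (pseudometric_sym q_pseudo)|rewrite fxy].
have fS : f @` S `<=` A by move=> _ [x Sx <-]; have [] := fP x Sx.
by rewrite -(card_le_eql (inj_card_eq f_inj)); exact: subset_card_le.
Qed.

Lemma separated_card_le_spanning (eps : R) (Y : set W) :
  (separated_card q (eps + eps) Y <= spanning_card q eps Y)%E.
Proof.
apply/ereal_supP => _ [S [SY sepS] <-]; apply/ereal_infP => _ [A [AY spanA] <-].
exact/le_counting/(separated_card_le_spanning_set eps Y).
Qed.

End SeparatedVersusSpanning.

Lemma separated_card_ge0 (R : realType) (W : choiceType) (q : W -> W -> R)
  (eps : R) (Y : set W) : (0 <= separated_card q eps Y)%E.
Proof.
apply: le_ereal_sup_tmp; exists (counting (@set0 W)); last exact: counting_ge0.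
by exists set0 => //; split=> // x y.
Qed.

Lemma spanning_card_ge0 (R : realType) (W : choiceType) (q : W -> W -> R)
  (eps : R) (Y : set W) : (0 <= spanning_card q eps Y)%E.
Proof. by apply/ereal_infP => _ [A _ <-]; exact: counting_ge0. Qed.

Lemma pseudometric_orbit_dist (R : realType) (X : uniformSpace R)
    (p : X -> X -> R) (n : nat) :
  pseudometric p -> pseudometric (@orbit_dist R X p n).
Proof.
move=> Pp; rewrite /orbit_dist; split.
- by move=> x y; exact: bigmax_ge_id.
- move=> x; apply: big1_idem => [|i _]; first exact: maxxx.
  exact: pseudometric_refl.
- by move=> x y; apply: eq_bigr => i _; exact: pseudometric_sym.
- move=> x y z; apply: bigmax_le => [|i _].
    by rewrite addr_ge0 ?bigmax_ge_id.
  apply: le_trans (pseudometric_triangle Pp (x i) (y i) (z i)) _.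
  apply: lerD; first exact: (le_bigmax 0 (fun j => p (x j) (y j))).
  exact: (le_bigmax 0 (fun j => p (y j) (z j))).
Qed.

Lemma le_limn_esup (R : realType) (u v : nat -> \bar R) :
  (forall n, u n <= v n)%E -> (limn_esup u <= limn_esup v)%E.
Proof.
move=> uv; apply/ereal_infP => _ [V FV <-].
apply: ge_ereal_inf; exists (ereal_sup (u @` V)); first by exists V.
apply/ereal_supP => _ [n Vn <-]; apply: le_trans (uv n) _.
by apply: ereal_sup_ubound; exists n.
Qed.

Lemma le_growth_rate (R : realType) (s t : nat -> \bar R) :
  (forall n, 0 <= s n)%E -> (forall n, s n <= t n)%E ->
  (limn_esup (fun n => (n%:R^-1)%:E * lne (s n)) <=
   limn_esup (fun n => (n%:R^-1)%:E * lne (t n)))%E.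
Proof.
move=> s0 st; apply: le_limn_esup => n; apply: lee_wpmul2l.
  by rewrite lee_fin invr_ge0.
by rewrite lee_lne ?in_itv /= ?leey ?s0 ?(le_trans (s0 n)).
Qed.

Theorem theorem3p10 (R : realType) (X : uniformSpace R)
    (Xcompact : compact [set: X])
    (phi : nat -> X -> set X)
    (phi_neq0 : forall (j : nat) (x : X), phi j x !=set0) :
  h_sep phi = h_span phi.
Proof.
have Pn p n : us_unif p -> pseudometric (@orbit_dist R X p n).
  move=> Up; apply: pseudometric_orbit_dist.
  exact: uniformity_pseudometric (us_unifP X) _ Up.
apply/eqP; rewrite eq_le; apply/andP; split.
- apply/ereal_supP => _ [p [eps [Up eps0 ->]]]; apply: le_ereal_sup_tmp.
  have eps20 : 0 < eps / 2 by rewrite divr_gt0.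
  eexists; first by exists p, (eps / 2); split.
  apply: le_growth_rate => n; first exact: separated_card_ge0.
  by rewrite /sep_number [eps in leLHS]splitr; exact/separated_card_le_spanning/Pn.
- apply/ereal_supP => _ [p [eps [Up eps0 ->]]]; apply: le_ereal_sup_tmp.
  eexists; first by exists p, eps; split.
  apply: le_growth_rate => n; first exact: spanning_card_ge0.
  by apply: spanning_card_le_separated (ltW eps0); exact: Pn.
Qed.
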